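(* For an integer $p \geq 2$, let $T_p$ be the left comb tree on $2p-1$ vertices: it consists of a path $\pi_1, \pi_2, \dots, \pi_p$ together with $p-1$ additional vertices $\ell_1,\dots,\ell_{p-1}$, where $\ell_{i-1}$ is a leaf adjacent to $\pi_i$ for $i = 2,\dots,p$. Then the sandpile group $K(\mathrm{Cone}(T_p))$ is cyclic, i.e. $\mu(\mathrm{Cone}(T_p)) = 1$, while $T_p$ has $\ell(T_p) = p$ leaves.
   Context: For a graph $G$ on vertex set $\{v_1,\dots,v_n\}$, the cone $\mathrm{Cone}(G)$ is obtained by adding a new vertex $v_0$ and one edge $\{v_0,v_i\}$ for each $i$. For a connected graph $G$ with Laplacian $L_G = D - A$, the sandpile group $K(G)$ is the torsion subgroup of $\mathrm{coker}(L_G:\mathbb{Z}^V\to\mathbb{Z}^V)$, equivalently $\mathbb{Z}^{n-1}/\mathrm{im}(\overline{L_G})$ with $\overline{L_G}$ the reduced Laplacian obtained by deleting the row and column of one vertex. $\mu(G)$ denotes the minimal number of generators of the finite abelian group $K(G)$, and $\ell(T)$ denotes the number of leaves of a tree $T$. *)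

(* Defs.v *)
From HB Require Import structures.
From mathcomp Require Import all_boot all_order all_algebra.
From mathcomp Require Import generic_quotient ring_quotient.
From mathcomp Require Import boolp.

Set Implicit Arguments.
Unset Strict Implicit.
Unset Printing Implicit Defensive.

Import GRing.Theory.
Local Open Scope ring_scope.

Record sgraph := SGraph {
  vertex :> finType;
  adj : rel vertex;
  adj_sym : symmetric adj;
  adj_irr : irreflexive adj
}.

Definition degree (G : sgraph) (v : G) : nat := #|[set w | adj v w]|.

Definition num_leaves (G : sgraph) : nat := #|[set v : G | degree v == 1%N]|.

(* [None] is the apex of the cone. *)
Definition cone_adj (G : sgraph) : rel (option G) := fun u v =>
  match u, v with
  | Some x, Some y => adj x y
  | None, None => false
  | _, _ => true
  end.

Lemma cone_adj_sym (G : sgraph) : symmetric (@cone_adj G).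
Proof. by move=> [x|] [y|] //=; rewrite adj_sym. Qed.

Lemma cone_adj_irr (G : sgraph) : irreflexive (@cone_adj G).
Proof. by move=> [x|] //=; rewrite adj_irr. Qed.

Definition cone (G : sgraph) : sgraph :=
  SGraph (@cone_adj_sym G) (@cone_adj_irr G).

(* Rows and columns are indexed by the vertices through [enum_val]. *)
Definition degree_mx (G : sgraph) : 'M[int]_#|G| :=
  diag_mx (\row_i (degree (enum_val i))%:Z).

Definition adjacency_mx (G : sgraph) : 'M[int]_#|G| :=
  \matrix_(i, j) (adj (enum_val i) (enum_val j) : nat)%:Z.

Definition laplacian (G : sgraph) : 'M[int]_#|G| :=
  degree_mx G - adjacency_mx G.

Section Cokernel.
Variables (m n : nat) (M : 'M[int]_(m, n)).

Definition im_mx : {pred 'cV[int]_m} :=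
  fun x => `[< exists y : 'cV[int]_n, x = M *m y >].

Lemma im_mx_zmod_closed : zmod_closed im_mx.
Proof.
split=> [|_ _ /asboolP [a ->] /asboolP [b ->]]; apply/asboolP.
  by exists 0; rewrite mulmx0.
by exists (a - b); rewrite mulmxBr.
Qed.

HB.instance Definition _ :=
  GRing.isZmodClosed.Build 'cV[int]_m im_mx im_mx_zmod_closed.

Definition coker : zmodType := Quotient.quot im_mx.

End Cokernel.

Section Torsion.
Variable A : zmodType.

Definition is_torsion : {pred A} :=
  fun x => `[< exists2 k : nat, (0 < k)%N & x *+ k = 0 >].

Lemma is_torsion_zmod_closed : zmod_closed is_torsion.
Proof.
split=> [|x y /asboolP [k k0 kx] /asboolP [l l0 ly]]; apply/asboolP.
  by exists 1%N.
exists (k * l)%N; first by rewrite muln_gt0 k0.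
by rewrite mulrnBl mulrnA kx mul0rn mulnC mulrnA ly mul0rn subr0.
Qed.

HB.instance Definition _ :=
  GRing.isZmodClosed.Build A is_torsion is_torsion_zmod_closed.

Definition torsion_sub := {x : A | x \in is_torsion}.

HB.instance Definition _ := SubChoice.on torsion_sub.
HB.instance Definition _ :=
  [SubChoice_isSubZmodule of torsion_sub by <:].

End Torsion.

Definition sandpile (G : sgraph) : zmodType := torsion_sub (coker (laplacian G)).

Definition generates (A : zmodType) (n : nat) (g : 'I_n -> A) : Prop :=
  forall x : A, exists c : 'I_n -> int, x = \sum_i g i *~ c i.

Definition n_generated (A : zmodType) : pred nat :=
  fun n => `[< exists g : 'I_n -> A, generates g >].

Definition cyclic_zmod (A : zmodType) : Prop :=
  exists g : A, forall x : A, exists k : int, x = g *~ k.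

(* The default value 0 is only taken when [A] is not finitely generated. *)
Definition min_generators (A : zmodType) : nat :=
  if pselect (exists n, n_generated A n) is left fgA then ex_minn fgA else 0%N.

Definition mu (G : sgraph) : nat := min_generators (sandpile G).

(* [inl i] is pi_(i+1) and [inr j] is l_(j+1), so that the leaf l_(j+1) hangs *)
(* from pi_(j+2) = [inl j.+1].                                                *)
Definition comb_adj (p : nat) : rel ('I_p + 'I_p.-1)%type := fun u v =>
  match u, v with
  | inl i, inl k => (k == i.+1 :> nat) || (i == k.+1 :> nat)
  | inl i, inr j | inr j, inl i => i == j.+1 :> nat
  | inr _, inr _ => false
  end.

Lemma comb_adj_sym p : symmetric (@comb_adj p).
Proof. by move=> [i|i] [j|j] //=; rewrite orbC. Qed.

Lemma comb_adj_irr p : irreflexive (@comb_adj p).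
Proof. by move=> [i|i] //=; rewrite orbb ltn_eqF. Qed.

Definition comb (p : nat) : sgraph :=
  SGraph (@comb_adj_sym p) (@comb_adj_irr p).

Lemma card_comb p : #|comb p| = (2 * p - 1)%N.
Proof.
rewrite card_sum !card_ord; case: p => [|p] //=.
by rewrite mulSn mul1n addnS subn1.
Qed.

(* Main.v *)
(* Let x_v be the class of v minus the class of the apex. These classes span  *)
(* the degree-zero part of the cokernel, which contains the torsion. With y_i *)
(* the class of the leaf at pi_i, the Laplacian relations read x_i = 2 y_i,   *)
(* x_(p-1) = 5 y_p, x_(i-1) = 7 y_i - x_(i+1) and 2 x_1 = x_2. Going down     *)
(* from i = p, the classes met so far are multiples of one element g, with    *)
(* y_i and x_(i-1) odd multiples. If x_(i-1) = (2c+1) g = 2 y_(i-1), then     *)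
(* g' = y_(i-1) - c g satisfies 2 g' = g and y_(i-1) = (2c+1) g', so g' may   *)
(* replace g. The last relation 2 x_1 = x_2 makes g torsion. The indicator of *)
(* {pi_1, l_1} is harmonic modulo 2 and takes the value 1 on x_1, so the      *)
(* group is not trivial.                                                      *)

Require Import Defs.
From mathcomp Require Import all_boot all_order all_algebra.
From mathcomp Require Import generic_quotient ring_quotient boolp zify ring.

Set Implicit Arguments.
Unset Strict Implicit.
Unset Printing Implicit Defensive.

Import GRing.Theory Num.Theory.
Local Open Scope quotient_scope.
Local Open Scope ring_scope.

(** Write p = n + 2. A function f with L f = 0 modulo d pairs with the image of the symmetric matrix
    L in multiples of d ([dvdz_config_class0]). For f = 1 and d = 0 this makes torsion classes have
    degree zero, so they are combinations of the classes [cone_class] ([torsion_cone_class]). The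
    relations at the comb vertices make all of these multiples of one torsion element
    ([comb_recurrence_cyclic], [cone_comb_cyclic]); f = [comb_parity] and d = 2 show that one of
    them is nonzero. *)

(** * Repeated halving of the generator *)

Definition multiple (A : zmodType) (g x : A) := exists k : int, x = g *~ k.

(* Here u k is x_(p-k) and w k is y_(p-k). The bound on b keeps the relation  *)
(* 2 x_1 = x_2 from being vacuous, so that it makes g torsion.                *)
Lemma comb_recurrence_cyclic (A : zmodType) (u w : nat -> A) (n : nat) :
    (forall k, (k <= n)%N -> u k = w k *+ 2) -> u 1%N = w 0%N *+ 5 ->
    (forall k, (k < n)%N -> u k.+2 = w k.+1 *+ 7 - u k) ->
  exists g : A, exists a b : int,
    [/\ 0 <= a, b <= 2 * a + 1, w n = g *~ (2 * a + 1),
        u n.+1 = g *~ (7 * (2 * a + 1) - 2 * b)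
      & forall k, (k <= n)%N -> multiple g (w k)].
Proof.
elim: n => [|n IHn] uw u1 rec.
  (* The choice b = 1 writes the coefficient 5 as 7 - 2. *)
  exists (w 0%N), 0, 1; split=> //.
  by move=> k; rewrite leqn0 => /eqP ->; exists 1.
have [||g [a [b [a_ge0 b_le wn un1 gen]]]] := IHn _ u1.
- by move=> k /leqW /uw.
- by move=> k /leqW /rec.
(* The coefficient of [u n.+1] is 2c + 1. *)
set c := 7 * a - b + 3.
pose g' := w n.+1 - g *~ c.
have gE : g = g' *~ 2.
  rewrite mulrzBl -mulrzA -[w _ *~ 2]pmulrn -uw // un1 -mulrzBr.
  by rewrite -[LHS]mulr1z; congr (_ *~ _); rewrite /c; ring.
have wE : w n.+1 = g' *~ (2 * c + 1).
  by rewrite mulrzDr mulrzA -gE addrC subrK.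
(* The new b satisfies [u n] = 2b g', since [u n] is twice [w n] and g = 2 g'. *)
exists g', c, (2 * (2 * a + 1)); split=> //.
- rewrite /c; lia.
- rewrite /c; lia.
- rewrite rec // uw ?leqnSn // wE wn gE !pmulrn -!mulrzA -mulrzBr.
  by congr (_ *~ _); ring.
move=> k; rewrite leq_eqVlt => /predU1P[->|/gen[m ->]].
  by exists (2 * c + 1).
by exists (2 * m); rewrite gE mulrzA.
Qed.

(** * Cokernel of the Laplacian of a graph *)

Definition config_class (G : sgraph) (c : G -> int) : coker (laplacian G) :=
  \pi_(coker (laplacian G)) (\col_i c (enum_val i)).

Definition vertex_class (G : sgraph) (v : G) : coker (laplacian G) :=
  config_class (fun u => (u == v)%:R).

Lemma laplacian_colE (G : sgraph) (h : G -> int) i :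
  (laplacian G *m \col_j h (enum_val j)) i 0 =
  \sum_(w | adj (enum_val i) w) (h (enum_val i) - h w).
Proof.
rewrite mulmxBl !mxE sumrB; congr (_ - _).
  rewrite (bigD1 i) //= !mxE eqxx mulr1n big1 ?addr0 => [|j ji].
    rewrite sumr_const /degree -mulr_natl natz; congr (_%:Z * _).
    by apply: eq_card => w; rewrite inE.
  by rewrite !mxE eq_sym (negbTE ji) mulr0n mul0r.
rewrite [RHS](reindex _ (onW_bij _ (@enum_val_bij _))) /=.
rewrite [RHS]big_mkcond; apply: eq_bigr => j _; rewrite !mxE.
by case: adj; rewrite ?mul1r ?mul0r.
Qed.

Lemma config_class_eq0 (G : sgraph) (c : G -> int) :
  config_class c = 0 <->
  exists h : G -> int, forall v, c v = \sum_(w | adj v w) (h v - h w).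
Proof.
have -> : (config_class c = 0) <->
    exists y : 'cV[int]_#|G|, \col_i c (enum_val i) = laplacian G *m y.
  rewrite /config_class -(raddf0 \pi_(coker (laplacian G))).
  by split=> [/eqP|cE]; last apply/eqP;
     rewrite -Quotient.idealrBE subr0 => //; [move/asboolP | apply/asboolP].
split=> [[y cE]|[h cE]].
  exists (fun v => y (enum_rank v) 0) => v.
  have -> : c v = (\col_i c (enum_val i)) (enum_rank v) 0.
    by rewrite mxE enum_rankK.
  rewrite cE -[in RHS](enum_rankK v) -laplacian_colE; congr ((_ *m _) _ _).
  by apply/matrixP=> i j; rewrite !mxE enum_valK ord1.
exists (\col_i h (enum_val i)); apply/matrixP=> i j.
by rewrite ord1 laplacian_colE mxE cE.
Qed.

Lemma config_classB (G : sgraph) (c d : G -> int) :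
  config_class (fun v => c v - d v) = config_class c - config_class d.
Proof.
rewrite /config_class -raddfB.
by apply: congr1; apply/matrixP=> i j; rewrite !mxE.
Qed.

Lemma config_classMn (G : sgraph) (c : G -> int) k :
  config_class (fun v => c v *+ k) = config_class c *+ k.
Proof.
rewrite /config_class -raddfMn.
by apply: congr1; apply/matrixP=> i j; rewrite mulmxnE !mxE.
Qed.

Lemma config_classE (G : sgraph) (c : G -> int) :
  config_class c = \sum_v vertex_class v *~ c v.
Proof.
rewrite /vertex_class /config_class.
under eq_bigr do rewrite -raddfMz.
rewrite -raddf_sum; apply: congr1; apply/matrixP=> i j; rewrite !mxE summxE.
rewrite (bigD1 (enum_val i)) //= big1 => [|v vi].
  by rewrite addr0 -scaler_int !mxE eqxx mulr1 intz.
by rewrite -scaler_int !mxE eq_sym (negbTE vi) mulr0.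
Qed.

Lemma config_class_surj (G : sgraph) (x : coker (laplacian G)) :
  exists c : G -> int, x = config_class c.
Proof.
exists (fun v => (repr x) (enum_rank v) 0).
rewrite -[LHS]reprK; apply: congr1; apply/matrixP=> i j.
by rewrite !mxE enum_valK ord1.
Qed.

Lemma laplacian_selfadjoint (G : sgraph) (f h : G -> int) :
  \sum_v f v * (\sum_(w | adj v w) (h v - h w)) =
  \sum_v h v * (\sum_(w | adj v w) (f v - f w)).
Proof.
under eq_bigr do rewrite sumrB mulrBr !big_distrr /=.
under [RHS]eq_bigr do rewrite sumrB mulrBr !big_distrr /=.
rewrite !sumrB; congr (_ - _).
  by apply: eq_bigr => v _; apply: eq_bigr => w _; rewrite mulrC.
rewrite (exchange_big_dep xpredT) //=; apply: eq_bigr => v _.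
by apply: eq_big => [w|w _]; rewrite 1?adj_sym 1?mulrC.
Qed.

(** A function harmonic modulo d induces a character of the cokernel with values in Z/d; d = 0 gives
    integer values. *)
Lemma dvdz_config_class0 (G : sgraph) (d : int) (f c : G -> int) :
    (forall v, (d %| \sum_(w | adj v w) (f v - f w))%Z) ->
  config_class c = 0 -> (d %| \sum_v f v * c v)%Z.
Proof.
move=> df /config_class_eq0[h cE].
under eq_bigr do rewrite cE.
by rewrite laplacian_selfadjoint rpred_sum // => v _; rewrite dvdz_mull.
Qed.

(** This is the relation given by column v of the Laplacian, read along the neighbours of v by
    symmetry. *)
Lemma vertex_class_laplacian (G : sgraph) (v : G) :
  \sum_(w | adj v w) (vertex_class v - vertex_class w) = 0.
Proof.
have -> : \sum_(w | adj v w) (vertex_class v - vertex_class w) =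
    config_class (fun u => \sum_(w | adj v w) ((u == v)%:R - (u == w)%:R)).
  under eq_bigr do rewrite -config_classB.
  rewrite /config_class -raddf_sum; apply: congr1.
  apply/matrixP=> i j; rewrite summxE !mxE.
  by apply: eq_bigr => w _; rewrite mxE.
apply/config_class_eq0; exists (fun u => (u == v)%:R) => u.
rewrite !sumrB; congr (_ - _).
  by have [->|] := eqVneq u v; rewrite // !big1.
have sum1 (a b : G) : \sum_(w | adj a w) (b == w)%:R = (adj a b)%:R :> int.
  rewrite big_mkcond (bigD1 b) //= eqxx big1 ?addr0 => [|w]; first by case: adj.
  by rewrite eq_sym => /negbTE ->; case: adj.
by under [RHS]eq_bigr do rewrite eq_sym; rewrite !sum1 adj_sym.
Qed.

(** * Classes relative to the apex of a cone *)

Lemma big_option (R : Type) (idx : R) (op : Monoid.com_law idx) (T : finType)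
    (P : pred (option T)) (F : option T -> R) :
  \big[op/idx]_(i | P i) F i =
  op (if P None then F None else idx)
     (\big[op/idx]_(i | P (Some i)) F (Some i)).
Proof.
rewrite big_mkcond (bigD1 None) //=; congr (op _ _).
rewrite (reindex_omap Some id) => [|[]//].
by rewrite [RHS]big_mkcond; apply: eq_bigl => x /=; rewrite eqxx.
Qed.

Definition cone_class (G : sgraph) (v : G) : coker (laplacian (cone G)) :=
  vertex_class (Some v : cone G) - vertex_class (None : cone G).

Lemma cone_class_laplacian (G : sgraph) (v : G) :
  cone_class v + \sum_(w | adj v w) (cone_class v - cone_class w) = 0.
Proof.
rewrite -[RHS](vertex_class_laplacian (Some v : cone G)) big_option /=.
by congr (_ + _); apply: eq_bigr => w _; rewrite opprB addrA subrK.
Qed.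

Lemma torsion_cone_class (G : sgraph) (z : coker (laplacian (cone G))) :
  z \in @is_torsion _ -> exists c : G -> int, z = \sum_v cone_class v *~ c v.
Proof.
have [c ->] := config_class_surj z; case/asboolP=> k k_gt0 kc0.
exists (c \o Some).
have c0 : \sum_v c v = 0.
  rewrite -config_classMn in kc0.
  (* Constants are harmonic, and divisibility by 0 is vanishing: k times the degree is 0. *)
  have := @dvdz_config_class0 _ 0 (fun=> 1) _ _ kc0.
  under eq_bigr do rewrite mul1r.
  rewrite dvd0z sumrMnl mulrn_eq0 gtn_eqF //= => c0; apply/eqP/c0 => v.
  by rewrite dvd0z big1 // => w; rewrite subrr.
rewrite config_classE big_option /=.
under [RHS]eq_bigr do rewrite mulrzBl.
rewrite sumrB addrC; congr (_ + _).
rewrite -mulrz_sumr -mulrNz; congr (_ *~ _).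
by apply/eqP; rewrite -addr_eq0; apply/eqP; rewrite -[RHS]c0 big_option.
Qed.

(** * Neighbourhoods in the comb *)

Lemma sum_adj (V : zmodType) (G : sgraph) (v : G) (s : seq G) (F : G -> V) :
  uniq s -> adj v =1 mem s -> \sum_(w | adj v w) F w = \sum_(w <- s) F w.
Proof. by move=> s_uniq sE; rewrite big_uniq //; apply: eq_bigl. Qed.

Lemma degree_size (G : sgraph) (v : G) (s : seq G) :
  uniq s -> adj v =1 mem s -> degree v = size s.
Proof.
move=> /card_uniqP <- sE; apply: eq_card => w.
by rewrite inE sE.
Qed.

(** Natural-number indices from 0: [tooth n k] hangs from [spine n k.+1]. Out-of-range indices fall
    to the default of [inord], hence the bounds below. *)
Definition spine n k : comb n.+2 := inl (inord k).
Definition tooth n k : comb n.+2 := inr (inord k).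

Lemma spine_val n (i : 'I_n.+2) : inl i = spine n i.
Proof. by rewrite /spine inord_val. Qed.

Lemma tooth_val n (i : 'I_n.+1) : inr i = tooth n i.
Proof. by rewrite /tooth inord_val. Qed.

Lemma spine_eq n (i : 'I_n.+2) k :
  (k < n.+2)%N -> (inl i == spine n k) = (i == k :> nat).
Proof. by move=> kn; rewrite -{2}(inordK kn). Qed.

Lemma tooth_eq n (i : 'I_n.+1) k :
  (k < n.+1)%N -> (inr i == tooth n k) = (i == k :> nat).
Proof. by move=> kn; rewrite -{2}(inordK kn). Qed.

Lemma spine_tooth_eq n (i : 'I_n.+2) k : (inl i == tooth n k) = false.
Proof. by []. Qed.

Lemma tooth_spine_eq n (i : 'I_n.+1) k : (inr i == spine n k) = false.
Proof. by []. Qed.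

Lemma adj_tooth n k : (k <= n)%N -> adj (tooth n k) =1 mem [:: spine n k.+1].
Proof. by move=> kn [i|i]; rewrite !inE /= ?spine_eq // !inordK. Qed.

Lemma adj_spine0 n : adj (spine n 0) =1 mem [:: spine n 1].
Proof.
by move=> [i|i]; rewrite !inE /= ?spine_eq // !inordK // orbF.
Qed.

Lemma adj_spine n k : (k < n)%N ->
  adj (spine n k.+1) =1 mem [:: spine n k; spine n k.+2; tooth n k].
Proof.
move=> kn [i|i];
  rewrite !inE /= ?(spine_tooth_eq, tooth_spine_eq) ?(spine_eq, tooth_eq);
  rewrite ?inordK; lia.
Qed.

Lemma adj_spine_last n : adj (spine n n.+1) =1 mem [:: spine n n; tooth n n].
Proof.
move=> [i|i]; have := ltn_ord i;
  rewrite !inE /= ?(spine_tooth_eq, tooth_spine_eq) ?(spine_eq, tooth_eq);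
  rewrite ?inordK; lia.
Qed.

Lemma uniq_adj_spine n k : (k < n)%N ->
  uniq [:: spine n k; spine n k.+2; tooth n k].
Proof.
by move=> kn; rewrite /= !inE spine_eq ?spine_tooth_eq ?inordK //; lia.
Qed.

(** The four cases are the four shapes of neighbourhood described above. *)
Lemma comb_vertexP n (v : comb n.+2) :
  [\/ v = spine n 0, exists2 k, (k <= n)%N & v = tooth n k,
      exists2 k, (k < n)%N & v = spine n k.+1 | v = spine n n.+1].
Proof.
case: v => [i|j]; last first.
  by constructor 2; exists j; rewrite ?tooth_val // -ltnS.
rewrite spine_val; case: (val i) (ltn_ord i) => [|k]; first by constructor 1.
rewrite !ltnS leq_eqVlt => /predU1P[->|kn]; first by constructor 4.
by constructor 3; exists k.
Qed.

(** * Relations in the cone over the comb *)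

(** The edge to the apex raises the degree by one and adds nothing on the right, the apex having
    relative class 0. *)
Lemma cone_class_adj (G : sgraph) (v : G) (s : seq G) :
    uniq s -> adj v =1 mem s ->
  cone_class v *+ (size s).+1 = \sum_(w <- s) cone_class w.
Proof.
move=> s_uniq sE; have := cone_class_laplacian v.
rewrite (sum_adj _ s_uniq sE) sumrB big_const_seq count_predT iter_addr_0.
by rewrite addrA -mulrS => /eqP; rewrite subr_eq0 => /eqP.
Qed.

Lemma cone_comb_tooth n k : (k <= n)%N ->
  cone_class (spine n k.+1) = cone_class (tooth n k) *+ 2.
Proof. by move=> kn; rewrite (cone_class_adj _ (adj_tooth kn)) // big_seq1. Qed.

Lemma cone_comb_spine0 n :
  cone_class (spine n 1) = cone_class (spine n 0) *+ 2.
Proof. by rewrite (cone_class_adj _ (@adj_spine0 n)) // big_seq1. Qed.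

Lemma cone_comb_spine n k : (k < n)%N ->
  cone_class (spine n k) =
  cone_class (tooth n k) *+ 7 - cone_class (spine n k.+2).
Proof.
move=> kn; have := cone_class_adj (uniq_adj_spine kn) (adj_spine kn).
rewrite cone_comb_tooth 1?ltnW // -mulrnA [(2 * _)%N](_ : _ = 7.+1) // mulrSr.
rewrite !big_cons big_nil addr0 (addrA (cone_class _)) => /addIr ->.
by rewrite addrK.
Qed.

Lemma cone_comb_spine_last n :
  cone_class (spine n n) = cone_class (tooth n n) *+ 5.
Proof.
have := cone_class_adj _ (@adj_spine_last n).
rewrite cone_comb_tooth // -mulrnA [(2 * _)%N](_ : _ = 5.+1) // mulrSr.
by rewrite !big_cons big_nil addr0 => /(_ isT) /addIr.
Qed.

Lemma cone_comb_cyclic n :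
  exists2 g : coker (laplacian (cone (comb n.+2))),
    g \in @is_torsion _ & forall v, multiple g (cone_class v).
Proof.
have [| | |g [a [b [a_ge0 b_le wn un gen]]]] :=
  @comb_recurrence_cyclic _ (fun k => cone_class (spine n (n.+1 - k)))
    (fun k => cone_class (tooth n (n - k))) n.
- by move=> k kn; rewrite subSn // cone_comb_tooth // leq_subr.
- by rewrite subSS !subn0 cone_comb_spine_last.
- move=> k kn; rewrite !subSS cone_comb_spine; last by lia.
  by congr (_ - cone_class (spine n _)); lia.
rewrite !subnn in wn un.
have tooth_gen k : (k <= n)%N -> multiple g (cone_class (tooth n k)).
  by move=> kn; rewrite -(subKn kn); apply: gen; rewrite leq_subr.
have spine_gen k : (k <= n)%N -> multiple g (cone_class (spine n k.+1)).
  move=> kn; have [m tE] := tooth_gen k kn.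
  by exists (m * 2); rewrite cone_comb_tooth // tE mulrzA.
exists g.
  (* Expressing both sides of 2 x_1 = x_2 through g gives an integer killing g; it is positive
     because b is at most 2a + 1 and a is nonnegative. *)
  have := cone_comb_spine0 n; rewrite cone_comb_tooth // un wn.
  rewrite !(pmulrn (_ *~ _)) -!mulrzA.
  move/eqP; rewrite eq_sym -subr_eq0 -mulrzBr => /eqP g0.
  apply/asboolP; exists (absz (12 * (2 * a + 1) - 4 * b)%R); first by lia.
  rewrite pmulrn -[RHS]g0; congr (_ *~ _); lia.
move=> v; case: (comb_vertexP v) => [->|[k kn ->]|[k kn ->]|->].
- by exists (7 * (2 * a + 1) - 2 * b).
- exact: tooth_gen.
- exact/spine_gen/ltnW.
- exact: spine_gen.
Qed.

(** * A character modulo 2 *)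

(* Harmonic on the cone modulo 2, hence a character of the sandpile group. *)
Definition comb_parity n (v : cone (comb n.+2)) : int :=
  if v is Some u then (u \in [:: spine n 0; tooth n 0])%:R else 0.

Arguments comb_parity n v : simpl never.

Lemma comb_parity_spine n k :
  (k < n.+2)%N -> comb_parity (Some (spine n k)) = (k == 0%N)%:R.
Proof.
by move=> kn; rewrite /comb_parity !inE spine_eq // spine_tooth_eq orbF inordK.
Qed.

Lemma comb_parity_tooth n k :
  (k < n.+1)%N -> comb_parity (Some (tooth n k)) = (k == 0%N)%:R.
Proof.
by move=> kn; rewrite /comb_parity !inE tooth_eq // tooth_spine_eq inordK.
Qed.

(** The sum is 2 at pi_1 and l_1, -2 at pi_2 and at the apex, and 0 elsewhere. *)
Lemma comb_parity_harmonic n (v : cone (comb n.+2)) :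
  (2 %| \sum_(w | adj v w) (comb_parity v - comb_parity w))%Z.
Proof.
case: v => [v|]; rewrite big_option /=.
  case: (comb_vertexP v) => [->|[k kn ->]|[k kn ->]|->].
  - rewrite (sum_adj _ _ (@adj_spine0 n)) // big_seq1.
    by rewrite !comb_parity_spine.
  - rewrite (sum_adj _ _ (adj_tooth kn)) // big_seq1.
    by rewrite comb_parity_spine // comb_parity_tooth //; case: eqP.
  - rewrite (sum_adj _ (uniq_adj_spine kn) (adj_spine kn)) !big_cons big_nil.
    rewrite !comb_parity_spine ?comb_parity_tooth //; try lia.
    by case: (k).
  - rewrite (sum_adj _ _ (@adj_spine_last n)) // !big_cons big_nil.
    by rewrite !comb_parity_spine ?comb_parity_tooth //; case: (n).
rewrite add0r sumrB big1_eq add0r.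
have -> : \sum_(u : comb n.+2) comb_parity (Some u) =
    #|[:: spine n 0; tooth n 0]|%:R.
  rewrite -sumr_const [RHS]big_mkcond; apply: eq_bigr => u _.
  by rewrite /comb_parity; case: (u \in _).
by rewrite (card_uniqP _).
Qed.

Lemma sum_mul_indicator (T : finType) (f : T -> int) (a : T) :
  \sum_v f v * (v == a)%:R = f a.
Proof.
rewrite (bigD1 a) //= eqxx mulr1 big1 ?addr0 // => v /negbTE ->.
by rewrite mulr0.
Qed.

Lemma cone_class_spine0_neq0 n : cone_class (spine n 0) != 0.
Proof.
apply/eqP; rewrite /cone_class /vertex_class -config_classB.
move/(dvdz_config_class0 (@comb_parity_harmonic n)).
under eq_bigr do rewrite mulrBr.
by rewrite sumrB !sum_mul_indicator comb_parity_spine.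
Qed.

(** * Cyclicity, nontriviality and leaves *)

Lemma sandpile_cone_comb_cyclic n : cyclic_zmod (sandpile (cone (comb n.+2))).
Proof.
have [g g_tors gen] := cone_comb_cyclic n.
exists (Sub g g_tors : torsion_sub _) => x.
have [c xE] := torsion_cone_class (valP x).
have [d dE] := choice gen.
exists (\sum_v d v * c v); apply: val_inj.
rewrite raddfMz xE [X in X *~ _]/= mulrz_sumr; apply: eq_bigr => v _.
by rewrite dE mulrzA.
Qed.

(** The nonzero class of pi_1 is torsion, being a multiple of g. *)
Lemma sandpile_cone_comb_nontrivial n :
  exists x : sandpile (cone (comb n.+2)), x != 0.
Proof.
have [g g_tors gen] := cone_comb_cyclic n.
have [k sE] := gen (spine n 0).
exists (Sub (g *~ k) (rpredMz _ g_tors) : torsion_sub _).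
by rewrite -(inj_eq val_inj) SubK raddf0 -sE cone_class_spine0_neq0.
Qed.

Lemma min_generators_cyclic (A : zmodType) :
  cyclic_zmod A -> (exists x : A, x != 0) -> min_generators A = 1%N.
Proof.
move=> [g gen] [x x_neq0].
have gen1 : n_generated A 1.
  apply/asboolP; exists (fun=> g) => y; have [k ->] := gen y.
  by exists (fun=> k); rewrite big_ord1.
rewrite /min_generators; case: pselect => [fgA|[]]; last by exists 1%N.
case: ex_minnP => -[|m] + /(_ _ gen1) m_le1; last by case: m m_le1.
(* An empty family generates only 0. *)
case/asboolP=> h /(_ x)[c]; rewrite big_ord0 => x0.
by rewrite x0 eqxx in x_neq0.
Qed.

(** Besides the n + 1 teeth, pi_1 is a leaf; pi_p is not, since it carries a tooth. *)
Lemma num_leaves_comb n : num_leaves (comb n.+2) = n.+2.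
Proof.
rewrite /num_leaves.
have -> : [set v : comb n.+2 | degree v == 1%N] =
    spine n 0 |: [set inr j | j : 'I_n.+1].
  apply/setP=> v; rewrite !inE.
  case: (comb_vertexP v) => [->|[k kn ->]|[k kn ->]|->].
  - by rewrite (degree_size _ (@adj_spine0 n)) ?eqxx.
  - by rewrite (degree_size _ (adj_tooth kn)) // imset_f ?orbT.
  - rewrite (degree_size (uniq_adj_spine kn) (adj_spine kn)) spine_eq //.
    rewrite inordK; last exact/ltnW.
    by apply/esym/negbTE/imsetP; case.
  - rewrite (degree_size _ (@adj_spine_last n)) // spine_eq // inordK //.
    by apply/esym/negbTE/imsetP; case.
rewrite cardsU1 card_imset; last by move=> i j [].
by rewrite card_ord; case: imsetP => [[]|].
Qed.

Local Open Scope nat_scope.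

Theorem theorem1p7 (p : nat) (hp : 2 <= p) :
  [/\ cyclic_zmod (sandpile (cone (comb p))),
      mu (cone (comb p)) = 1
    & num_leaves (comb p) = p].
Proof.
case: p hp => [|[|n]] // _; have cyc := sandpile_cone_comb_cyclic n.
split=> //; last exact: num_leaves_comb.
exact/min_generators_cyclic/sandpile_cone_comb_nontrivial.
Qed.
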